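(* Let $n\ge 1$, let $\alpha_1,\ldots,\alpha_n\in\mathbb{R}$, and let $J_n$ be the $n\times n$ matrix built from $\alpha_1,\ldots,\alpha_n$ as described in the context. Then the $n$ eigenvalues $\lambda_1,\ldots,\lambda_n\in\mathbb{C}$ of $J_n$ (counted with algebraic multiplicity) are the $n$ roots (counted with multiplicity) of the polynomial $\Re\{Q_n(x)\}$ defined in the context.
   Context: $J_n=U_nV_n\in\mathbb{R}^{n\times n}$, where $U_n$ is the upper triangular matrix with entries $(U_n)_{ii}=\frac{\alpha_i+1}{2}$, $(U_n)_{ij}=\alpha_j$ for $i<j$, and $(U_n)_{ij}=0$ for $i>j$; and $V_n$ is the lower triangular matrix with entries $(V_n)_{ii}=\frac{\alpha_i+1}{2}$, $(V_n)_{ij}=\alpha_j$ for $i>j$, and $(V_n)_{ij}=0$ for $i<j$. With $j$ the imaginary unit, $\Re\{Q_n(x)\}$ denotes the polynomial in $x$ of degree $n$ with real coefficients whose value at every real $x>1/4$ is the real part of $$Q_n(x)=\left(1+\frac{j}{\sqrt{4x-1}}\right)\prod_{i=1}^{n}\left(\frac{\sqrt{4x-1}}{2}+j\,\frac{\alpha_i}{2}\right)^2 ;$$ its roots are taken in $\mathbb{C}$. *)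

(* Defs.v *)
From HB Require Import structures.
From mathcomp Require Import all_boot all_order all_algebra.
From mathcomp Require Import reals complex.

Set Implicit Arguments.
Unset Strict Implicit.
Unset Printing Implicit Defensive.

Import Order.TTheory GRing.Theory Num.Theory.
Local Open Scope ring_scope.
Local Open Scope complex_scope.

Definition Umx (R : realType) (n : nat) (alpha : 'I_n -> R) : 'M[R]_n :=
  \matrix_(i < n, j < n)
    (if i == j then (alpha i + 1) / 2
     else if (i < j)%N then alpha j else 0).

Definition Vmx (R : realType) (n : nat) (alpha : 'I_n -> R) : 'M[R]_n :=
  \matrix_(i < n, j < n)
    (if i == j then (alpha i + 1) / 2
     else if (j < i)%N then alpha j else 0).

Definition Jmx (R : realType) (n : nat) (alpha : 'I_n -> R) : 'M[R]_n :=
  Umx alpha *m Vmx alpha.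

(* Only meaningful for x > 1/4: otherwise Num.sqrt (4 * x - 1) is 0. *)
Definition Qn (R : realType) (n : nat) (alpha : 'I_n -> R) (x : R) : R[i] :=
  let s : R := Num.sqrt (4 * x - 1) in
  (1 + 'i%C / s%:C) * \prod_(k < n) ((s / 2)%:C + 'i%C * (alpha k / 2)%:C) ^+ 2.

Definition is_ReQ (R : realType) (n : nat) (alpha : 'I_n -> R)
    (p : {poly R}) : Prop :=
  size p = n.+1 /\ forall x : R, 1 / 4 < x -> p.[x] = complex.Re (Qn alpha x).

Definition lists_eigenvalues (R : realType) (n : nat) (A : 'M[R]_n)
    (s : seq R[i]) : Prop :=
  let AC := map_mx (real_complex R) A in
  (forall z : R[i], (z \in s) = eigenvalue AC z) /\
  (forall z : R[i], count_mem z s = mup z (char_poly AC)).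

(* [mup z 0] is not a root multiplicity, whence the condition [p != 0]. *)
Definition lists_roots (R : realType) (p : {poly R}) (s : seq R[i]) : Prop :=
  let pC := map_poly (real_complex R) p in
  [/\ p != 0,
      (forall z : R[i], (z \in s) = root pC z) &
      (forall z : R[i], count_mem z s = mup z pC)].

(* Main.v *)
Require Import Defs.
From HB Require Import structures.
From mathcomp Require Import all_boot all_order all_algebra.
From mathcomp Require Import reals complex.
From mathcomp Require Import ring lra.

Set Implicit Arguments.
Unset Strict Implicit.
Unset Printing Implicit Defensive.

Import Order.TTheory GRing.Theory Num.Theory.
Local Open Scope ring_scope.
Local Open Scope complex_scope.

(** Subtracting 1/2 from the diagonal leaves A = U_n - 1/2, which is upper
    triangular, and B = V_n - 1/2, which is lower triangular; both have the
    diagonal alpha_k / 2, and every entry of column l of A + B is alpha_l, so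
    that A + B = u v with u the column of ones and v the row of the alpha_k.
    Write x = t^2 + 1/4, that is t = sqrt(4x - 1) / 2.  Eliminating B,

      x - (A + 1/2) (B + 1/2) = (t^2 + A^2) - (A + 1/2) u v,

    so det(x - J_n) is the determinant of a rank-one perturbation of a
    triangular matrix.  Over the complex numbers t^2 + A^2 factors as
    (t + iA) (t - iA), with determinant P P' where P is the product of the
    t + i alpha_k / 2 and P' that of the t - i alpha_k / 2.  Partial fractions
    reduce the correction term to v (t + iA)^-1 u and v (t - iA)^-1 u.  These
    two scalars are known, again by the rank-one formula: t - iB is
    t + iA - i u v, and its determinant is P' because B is triangular with the
    diagonal of A; symmetrically for t + iB.  The outcome is

      det(x - J_n) = ((1 + i/2t) P^2 + (1 - i/2t) P'^2) / 2
                                        ([det_scalar_sub_mul_trig]),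

    and for real x > 1/4 the two summands are conjugate, the first one being
    Q_n(x): the right-hand side is Re Q_n(x) ([horner_char_poly_Jmx]).  Two
    polynomials that agree for all x > 1/4 are equal, so Re Q_n, as a
    polynomial, is the characteristic polynomial of J_n.  The list of its
    complex roots is then the list of eigenvalues. *)

(** Both sides are the determinant of the block matrix with rows (1, - v) and
    (u, M), computed by eliminating u with the entry 1, respectively with M. *)
Lemma det_rank_one_update (F : fieldType) (n : nat) (M : 'M[F]_n)
    (u : 'cV[F]_n) (v : 'rV[F]_n) :
  M \in unitmx ->
  \det (M + u *m v) = \det M * (1 + (v *m invmx M *m u) 0 0).
Proof.
move=> Munit.
pose S : 'M[F]_1 := 1%:M + v *m invmx M *m u.
have Eleft : block_mx 1%:M 0 u 1%:M *m block_mx 1%:M (- v) 0 (M + u *m v)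
           = block_mx (1%:M : 'M_1) (- v) u M.
  rewrite mulmx_block !mul0mx !mulmx0 !mul1mx !mulmx1 !addr0.
  by rewrite mulmxN addrCA addNr addr0.
have Eright : block_mx S (- v) 0 M *m block_mx 1%:M 0 (invmx M *m u) 1%:M
            = block_mx (1%:M : 'M_1) (- v) u M.
  rewrite mulmx_block !mul0mx !mulmx0 !mulmx1 !add0r.
  by rewrite !mulmxA mulmxV // mul1mx !mulNmx addrK.
have := congr1 (fun X => \det X) (etrans Eleft (esym Eright)).
rewrite /= !det_mulmx !det_lblock !det_ublock !det1 !mul1r !mulr1 => ->.
by rewrite mulrC [\det S]det_mx11 !mxE.
Qed.

Lemma det_scalar_add_trig (F : fieldType) (n : nat) (B : 'M[F]_n) (z y : F) :
  is_trig_mx B -> \det (z%:M + y *: B) = \prod_k (z + y * B k k).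
Proof.
move=> /is_trig_mxP Btrig; rewrite det_trig.
  by apply: eq_bigr => k _; rewrite !mxE eqxx.
apply/is_trig_mxP => a b ab; rewrite !mxE Btrig // mulr0 addr0.
by rewrite -val_eqE /= ltn_eqF.
Qed.

(** Stated over any field with a square root i of -1, since the identity is
    purely algebraic: over the complex numbers, P and P' become conjugate once
    t and the diagonal of A are real.  The constant (1/2)^2 cancels the one
    produced by the two shifts by 1/2. *)
Lemma det_scalar_sub_mul_trig (F : fieldType) (n : nat) (A B : 'M[F]_n)
    (u : 'cV[F]_n) (v : 'rV[F]_n) (i t : F) :
  (2 : F) != 0 -> i ^+ 2 = -1 -> t != 0 ->
  is_trig_mx A^T -> is_trig_mx B -> (forall k, A k k = B k k) ->
  A + B = u *m v ->
  let P := \prod_k (t + i * A k k) in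
  let P' := \prod_k (t - i * A k k) in
  P != 0 -> P' != 0 ->
  \det ((t ^+ 2 + 2^-1 ^+ 2)%:M - (A + (2^-1)%:M) *m (B + (2^-1)%:M))
  = ((1 + i / (2 * t)) * P ^+ 2 + (1 - i / (2 * t)) * P' ^+ 2) / 2.
Proof.
move=> two0 i2 t0 Atrig Btrig diagAB AB P P' P0 P'0.
have detA y : \det (t%:M + y *: A) = \prod_k (t + y * A k k).
  rewrite -det_tr linearD /= tr_scalar_mx linearZ /= det_scalar_add_trig //.
  by apply: eq_bigr => k _; rewrite mxE.
have detB y : \det (t%:M + y *: B) = \prod_k (t + y * A k k).
  by rewrite det_scalar_add_trig //; apply: eq_bigr => k _; rewrite diagAB.
have P'E : \prod_k (t + - i * A k k) = P'.
  by apply: eq_bigr => k _; rewrite mulNr.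
pose M := t%:M + i *: A; pose M' := t%:M + (- i) *: A.
have detM : \det M = P by rewrite /M detA.
have detM' : \det M' = P' by rewrite /M' detA P'E.
have Mu : M \in unitmx by rewrite unitmxE detM unitfE.
have Mu' : M' \in unitmx by rewrite unitmxE detM' unitfE.
pose a := (v *m invmx M *m u) 0 0; pose b := (v *m invmx M' *m u) 0 0.
(* Since B = u v - A, the matrices t - iB and t + iB are rank-one updates of
   M and M', which determines a and b from P and P'. *)
have BE : B = u *m v - A by rewrite -AB addrC addKr.
have Ha : P' = P * (1 - i * a).
  rewrite -P'E -detB -detM.
  have -> : t%:M + - i *: B = M + (- i *: u) *m v.
    by rewrite BE /M -scalemxAl scalerBr !scaleNr opprK addrA addrAC.
  by rewrite det_rank_one_update // -scalemxAr mxE -/a mulNr.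
have Hb : P = P' * (1 + i * b).
  rewrite -[P](detB i) -detM'.
  have -> : t%:M + i *: B = M' + (i *: u) *m v.
    by rewrite BE /M' -scalemxAl scalerBr scaleNr addrA addrAC.
  by rewrite det_rank_one_update // -scalemxAr mxE -/b.
(* Coefficients of the partial fraction decomposition
   (A + 1/2) / (M M') = c / M + c' / M'. *)
pose c := i / 2 + (4 * t)^-1; pose c' := - (i / 2) + (4 * t)^-1.
have four0 : (4 : F) != 0 by rewrite (_ : 4 = 2 * 2) ?mulf_neq0 //; ring.
have MM' : M *m M' = (t ^+ 2)%:M + A *m A.
  rewrite /M /M' mulmxDl !mulmxDr -scalar_mxM !mul_scalar_mx mul_mx_scalar.
  rewrite -scalemxAl -scalemxAr; move: (A *m A) => AA.
  by apply/matrixP => k l; rewrite !mxE; case: (k == l); ring: i2.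
have M'M : M' *m M = M *m M'.
  rewrite MM' /M /M' mulmxDl !mulmxDr -scalar_mxM !mul_scalar_mx mul_mx_scalar.
  rewrite -scalemxAl -scalemxAr; move: (A *m A) => AA.
  by apply/matrixP => k l; rewrite !mxE; case: (k == l); ring: i2.
have fracE : c *: M' + c' *: M = A + (2^-1)%:M.
  have sumc : (c + c') * t = 2^-1.
    by rewrite /c /c'; field; rewrite two0 t0 four0.
  have diffc : i * (c' - c) = 1.
    have -> : i * (c' - c) = - i ^+ 2.
      by rewrite /c /c'; field; rewrite two0 t0 four0.
    by rewrite i2 opprK.
  have -> : c *: M' + c' *: M = ((c + c') * t)%:M + (i * (c' - c)) *: A.
    apply/matrixP => k l; rewrite !mxE.
    by case: (k == l); rewrite /= ?mulr1n ?mulr0n; ring.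
  by rewrite sumc diffc scale1r addrC.
have -> : (t ^+ 2 + 2^-1 ^+ 2)%:M - (A + (2^-1)%:M) *m (B + (2^-1)%:M)
        = M *m M' + (- (A + (2^-1)%:M) *m u) *m v.
  rewrite MM' BE !mulNmx -mulmxA; move: (u *m v) => E.
  rewrite !mulmxDl !mulmxDr !mulmxN !mul_scalar_mx mul_mx_scalar.
  move: (A *m A) (A *m E) => AA AE.
  apply/matrixP => k l; rewrite !mxE.
  by case: (k == l); rewrite /= ?mulr1n ?mulr0n; field.
rewrite det_rank_one_update; last by rewrite unitmx_mul Mu.
(* Hiding the sums behind M and M' keeps distributivity from unfolding them. *)
clearbody M M'.
have invE : invmx (M *m M') *m (A + (2^-1)%:M) = c *: invmx M + c' *: invmx M'.
  rewrite -fracE.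
  have MM'u : M *m M' \in unitmx by rewrite unitmx_mul Mu.
  apply: (can_inj (mulKmx MM'u)).
  by rewrite mulKVmx // mulmxDr -!scalemxAr mulmxK // -M'M mulmxK.
rewrite -mulmxA [invmx _ *m _]mulmxA [invmx _ *m _]mulmxN invE.
rewrite !(mulNmx, mulmxN) mulmxDl mulmxDr -!scalemxAl -!scalemxAr !mulmxA.
rewrite [v *m invmx M *m u]mx11_scalar [v *m invmx M' *m u]mx11_scalar -/a -/b.
rewrite !mxE !mulr1n det_mulmx detM detM'.
have Pa : P * a = - i * (P - P').
  rewrite Ha; ring: i2.
have P'b : P' * b = - i * (P - P').
  rewrite Hb; ring: i2.
(* Grouped so that a and b occur only in P a and P' b, both of which equal
   - i (P - P'). *)
transitivity (P * P' - c * P' * (P * a) - c' * P * (P' * b)); first ring.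
rewrite Pa P'b.
transitivity (P * P' + (i * c * P' + i * c' * P) * (P - P')); first ring.
have ic : i * c = - 2^-1 + i / (4 * t).
  by rewrite /c mulrDr mulrA -expr2 i2 mulN1r.
have ic' : i * c' = 2^-1 + i / (4 * t).
  by rewrite /c' mulrDr mulrN mulrA -expr2 i2 mulN1r opprK.
rewrite ic ic'; field; by rewrite ?two0 ?t0 ?four0.
Qed.

Lemma horner_char_poly (R : comNzRingType) (n : nat) (A : 'M[R]_n) (x : R) :
  (char_poly A).[x] = \det (x%:M - A).
Proof.
rewrite -horner_evalE /char_poly -det_map_mx; congr (\det _).
by apply/matrixP => k l; rewrite !mxE /= horner_evalE !hornerE hornerMn hornerX.
Qed.

Lemma horner_char_poly_Jmx (R : realType) (n : nat) (alpha : 'I_n -> R)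
    (x : R) :
  1 / 4 < x -> (char_poly (Jmx alpha)).[x] = complex.Re (Qn alpha x).
Proof.
move=> x_gt; pose s := Num.sqrt (4 * x - 1).
have s2 : s ^+ 2 = 4 * x - 1 by rewrite sqr_sqrtr //; lra.
have s0 : s != 0 by rewrite sqrtr_eq0 -ltNge; lra.
pose t : R[i] := (s / 2)%:C.
pose A := map_mx (real_complex R) (Umx alpha - (2^-1)%:M).
pose B := map_mx (real_complex R) (Vmx alpha - (2^-1)%:M).
have diagA k : A k k = (alpha k / 2)%:C.
  by rewrite !mxE eqxx mulr1n; congr (_%:C); field.
have diagB k : B k k = (alpha k / 2)%:C.
  by rewrite !mxE eqxx mulr1n; congr (_%:C); field.
pose P := \prod_k (t + 'i%C * A k k); pose P' := \prod_k (t - 'i%C * A k k).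
have P'J : P' = (P^*)%C.
  rewrite /P rmorph_prod; apply: eq_bigr => k _; rewrite diagA /t; simpc.
  by [].
have PE : P = \prod_k ((s / 2)%:C + 'i%C * (alpha k / 2)%:C).
  by apply: eq_bigr => k _; rewrite diagA.
have P0 : P != 0.
  rewrite PE; apply/prodf_neq0 => k _; rewrite eq_complex /=.
  by rewrite !(mul0r, mulr0) subrr addr0 mulf_eq0 (negPf s0) invr_eq0 pnatr_eq0.
have P'0 : P' != 0 by rewrite P'J conjc_eq0.
apply: (@complexI R).
have -> : (char_poly (Jmx alpha)).[x]%:C
        = \det ((t ^+ 2 + 2^-1 ^+ 2)%:M - (A + (2^-1)%:M) *m (B + (2^-1)%:M)).
  have half : (2^-1 : R[i]) = (2^-1)%:C by rewrite fmorphV rmorph_nat.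
  have addhalf (W : 'M[R]_n) : map_mx (real_complex R) W
      = map_mx (real_complex R) (W - (2^-1)%:M) + (2^-1)%:M.
    by rewrite map_mxB map_scalar_mx half subrK.
  have xE : x%:C = t ^+ 2 + 2^-1 ^+ 2.
    rewrite /t half -!rmorphXn -rmorphD; congr (_%:C).
    by rewrite expr_div_n s2; field.
  transitivity (\det (x%:C%:M - map_mx (real_complex R) (Umx alpha)
                                *m map_mx (real_complex R) (Vmx alpha))).
    by rewrite horner_char_poly -det_map_mx map_mxB map_scalar_mx map_mxM.
  by rewrite xE (addhalf (Umx alpha)) (addhalf (Vmx alpha)).
have two_t : 2 * t = s%:C.
  by rewrite /t -(rmorph_nat (real_complex R) 2) -rmorphM /=; congr (_%:C); field.
rewrite (@det_scalar_sub_mul_trig _ _ _ _ (const_mx 1)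
           (\row_k (alpha k)%:C) 'i%C).
- rewrite -/P -/P' P'J two_t ReJ_add /Qn -/s prodrXl -PE; congr (_ / 2).
  congr (_ + _); rewrite [RHS]rmorphM rmorphXn; congr (_ * _).
  rewrite rmorphD rmorph1 rmorphM fmorphV -mulNr.
  congr (_ + _ / _); last exact/esym/conjc_real.
  by apply/eqP; rewrite eq_complex /= oppr0 !eqxx.
- by rewrite pnatr_eq0.
- exact: sqr_i.
- by rewrite /t fmorph_eq0 mulf_neq0 ?invr_neq0 ?pnatr_eq0.
- apply/is_trig_mxP => k l kl; rewrite !mxE eq_sym -val_eqE /= (ltn_eqF kl).
  by rewrite ltnNge ltnW // subr0.
- apply/is_trig_mxP => k l kl; rewrite !mxE -val_eqE /= (ltn_eqF kl).
  by rewrite ltnNge ltnW // subr0.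
- by move=> k; rewrite diagA diagB.
- apply/matrixP => k l; rewrite [RHS]mxE big_ord1 !mxE mul1r -rmorphD /=.
  congr (_%:C); case: (eqVneq k l) => [->|kl]; first by rewrite mulr1n; field.
  rewrite mulr0n !subr0; case: ltngtP => [_|_|/val_inj/eqP].
  + by rewrite addr0.
  + by rewrite add0r.
  + by rewrite (negPf kl).
- exact: P0.
- exact: P'0.
Qed.

Lemma poly_eq_on_ray (R : numDomainType) (a : R) (p q : {poly R}) :
  (forall x, a < x -> p.[x] = q.[x]) -> p = q.
Proof.
move=> eq_pq; apply/eqP; rewrite -subr_eq0; apply/eqP.
pose rs := [seq a + k.+1%:R | k <- iota 0 (size (p - q))].
apply: (@roots_geq_poly_eq0 _ _ rs); last by rewrite size_map size_iota.
  apply/allP => _ /mapP[k _ ->]; rewrite rootE !hornerE eq_pq ?subrr //.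
  by rewrite ltrDl ltr0Sn.
rewrite map_inj_uniq ?iota_uniq // => k l /addrI /eqP.
by rewrite eqr_nat eqSS => /eqP.
Qed.

Lemma is_ReQ_char_poly_Jmx (R : realType) (n : nat) (alpha : 'I_n -> R) :
  unique (is_ReQ alpha) (char_poly (Jmx alpha)).
Proof.
split.
  by split; [rewrite size_char_poly | exact: horner_char_poly_Jmx].
move=> q [_ qE]; apply: (@poly_eq_on_ray _ (1 / 4)) => x x_gt.
by rewrite horner_char_poly_Jmx ?qE.
Qed.

Theorem theorem4p1 (R : realType) (n : nat) (alpha : 'I_n -> R) :
  (0 < n)%N ->
  exists p : {poly R},
    unique (is_ReQ alpha) p /\
    exists lambda : n.-tuple R[i],
      lists_eigenvalues (Jmx alpha) lambda /\ lists_roots p lambda.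
Proof.
move=> _; exists (char_poly (Jmx alpha)); split.
  exact: is_ReQ_char_poly_Jmx.
set AC := map_mx (real_complex R) (Jmx alpha).
have mapE : map_poly (real_complex R) (char_poly (Jmx alpha)) = char_poly AC.
  by rewrite map_char_poly.
have [r] := closed_field_poly_normal (char_poly AC).
rewrite (monicP (char_poly_monic AC)) scale1r => rE.
have size_r : size r == n.
  by rewrite -eqSS -(size_prod_XsubC r id) -rE size_char_poly.
exists (Tuple size_r); split.
  split=> z /=; rewrite -/AC ?eigenvalue_root_char rE.
    by rewrite root_prod_XsubC.
  by rewrite mu_prod_XsubC.
split=> [|z /=|z /=]; rewrite ?mapE ?rE.
- exact: monic_neq0 (char_poly_monic _).
- by rewrite root_prod_XsubC.
- by rewrite mu_prod_XsubC.
Qed.
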